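(* Let $H=(kG)^*\#kL$ be a cocentral abelian extension with trivial cocycles $\sigma$ and $\tau$. Let $g\in G$, let $V$ be a simple $kL_g$-module with character $\chi$, and let $\hat V=\operatorname{Ind}_{L_g}^L V$, regarded as an $H$-module, with character $\hat\chi$. Then $$\nu_H(\hat\chi)=\nu_g(\chi),$$ i.e. the $H$-indicator of $\hat\chi$ equals the local indicator of $\chi$.
   Context: $k$ is an algebraically closed field of characteristic not $2$; $G,L$ are finite groups with $\operatorname{char}k\nmid |G||L|$; $L$ acts on $G$ by group automorphisms, $(x,g)\mapsto x\rightharpoonup g$. Let $\{p_g\}_{g\in G}$ be the basis of $(kG)^*$ dual to $G$. The cocentral abelian extension with trivial cocycles $H=(kG)^*\#kL$ is the Hopf algebra with basis $\{p_gx: g\in G,x\in L\}$, unit $\sum_g p_g1$ and $$(p_gx)(p_hy)=\delta_{g,\,x\rightharpoonup h}\,p_g(xy),\qquad \Delta(p_gx)=\sum_{h\in G}p_hx\otimes p_{h^{-1}g}x,\qquad \varepsilon(p_gx)=\delta_{g,1},\qquad S(p_gx)=p_{x^{-1}\rightharpoonup g^{-1}}x^{-1}.$$ Schur indicator: for a semisimple Hopf algebra $A$ with integral $\Lambda$, $\varepsilon(\Lambda)=1$, put $\Lambda^{[2]}=\sum\Lambda_1\Lambda_2$ and $\nu_A(\chi)=\chi(\Lambda^{[2]})$ for a character $\chi$. For a group algebra $kF$ this is $\frac1{|F|}\sum_{z\in F}\chi(z^2)$. Notation: $L_{g,h}=\{y\in L: y\rightharpoonup g=h\}$; $L_g=L_{g,g}$;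 $\tilde L_g=L_g\cup L_{g,g^{-1}}$ (a subgroup of $L$). $\hat V=kL\otimes_{kL_g}V$ is an $H$-module via $(p_hx)\cdot(y\otimes v)=\delta_{xy\rightharpoonup g,\,h}\,xy\otimes v$. Local indicator: for an $L_g$-module $V$ with character $\chi$, let $\tilde\chi$ be the character of $\tilde V=\operatorname{Ind}_{L_g}^{\tilde L_g}V$, let $\nu(\chi)$ be the classical Frobenius–Schur indicator of $\chi$ for $kL_g$ and $\tilde\nu(\tilde\chi)$ that of $\tilde\chi$ for $k\tilde L_g$. Then $\nu_g(\chi):=\nu(\chi)$ if $g^2=1$, and $\nu_g(\chi):=\tilde\nu(\tilde\chi)-\nu(\chi)$ if $g$ has order at least $3$. *)

(* Defs.v *)
From HB Require Import structures.
From mathcomp Require Import all_boot all_algebra all_fingroup all_field.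

Set Implicit Arguments.
Unset Strict Implicit.
Unset Printing Implicit Defensive.

Import GRing.Theory passmx.
Local Open Scope ring_scope.

(* MathComp's [groupAction]s are right actions; the actions below are left
   actions of the whole group [lT] on the whole group [gT]. *)
Record left_aut_action (lT gT : finGroupType) := LeftAutAction {
  aut_act :> lT -> gT -> gT;
  aut_act1 : forall g, aut_act 1%g g = g;
  aut_actM : forall x y g, aut_act (x * y)%g g = aut_act x (aut_act y g);
  aut_act_morph : forall x g h,
    aut_act x (g * h)%g = (aut_act x g * aut_act x h)%g
}.

Section ActionTheory.

Variables (lT gT : finGroupType) (a : left_aut_action lT gT).
Implicit Types (x y : lT) (g h : gT).

Lemma aut_actK x : cancel (a x) (a x^-1%g).
Proof. by move=> g; rewrite -aut_actM mulVg aut_act1. Qed.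

Lemma aut_actKV x : cancel (a x^-1%g) (a x).
Proof. by move=> g; rewrite -aut_actM mulgV aut_act1. Qed.

Lemma aut_act_one x : a x 1%g = 1%g.
Proof. by apply: (@mulgI _ (a x 1%g)); rewrite -aut_act_morph !mulg1. Qed.

Lemma aut_actV x g : a x g^-1%g = (a x g)^-1%g.
Proof.
by apply: (@mulgI _ (a x g)); rewrite -aut_act_morph !mulgV aut_act_one.
Qed.

Definition transporter g h : {set lT} := [set y | a y g == h].

Definition stab g : {set lT} := transporter g g.

Lemma stab_group_set g : group_set (stab g).
Proof.
apply/group_setP; split=> [|x y]; rewrite !inE ?aut_act1 // => /eqP xg /eqP yg.
by rewrite aut_actM yg xg.
Qed.

Canonical stab_group g := Group (stab_group_set g).

Definition ext_stab g : {set lT} := stab g :|: transporter g g^-1%g.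

Lemma ext_stab_group_set g : group_set (ext_stab g).
Proof.
apply/group_setP; split=> [|x y]; rewrite !inE ?aut_act1 ?eqxx //.
rewrite aut_actM => /orP[] /eqP xg /orP[] /eqP yg;
  by rewrite yg ?aut_actV xg ?invgK eqxx ?orbT.
Qed.

Canonical ext_stab_group g := Group (ext_stab_group_set g).

End ActionTheory.

Section LinearTrace.

Variables (k : fieldType) (V : vectType k).

Definition lftrace (f : 'End(V)) : k :=
  \tr (mxof (vbasis {:V}) (vbasis {:V}) f).

End LinearTrace.

Section Quotient.

Variables (k : fieldType) (W : vectType k) (R : {vspace W}).

(* The quotient W / R, realized on the chosen complement of R; [quov_pi] is
   the projection W -> W / R. *)
Definition quov := subvs_of (R^C)%VS.

HB.instance Definition _ := Vector.on quov.

Definition quov_pi : 'Hom(W, quov) :=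
  linfun (vsproj (R^C)%VS \o (\1 - projv R)%VF).

Definition quov_repr : 'Hom(quov, W) := linfun (vsval : quov -> W).

Lemma quov_piE w : vsval (quov_pi w : subvs_of _) = w - projv R w.
Proof.
by rewrite lfunE /= vsprojK ?add_lfunE ?opp_lfunE ?id_lfunE ?memv_projC.
Qed.

Lemma lker_quov_pi : lker quov_pi = R.
Proof.
apply/vspaceP=> w; rewrite memv_ker -val_eqE /= quov_piE subr_eq0.
by apply/eqP/idP=> [->|/projv_id->//]; apply: memv_proj.
Qed.

Lemma quov_reprK : cancel quov_repr quov_pi.
Proof.
move=> u; apply: val_inj; rewrite /= quov_piE lfunE /=.
have uC : vsval u \in (R^C)%VS by apply: subvsP.
apply/eqP; rewrite subr_eq addrC -subr_eq subrr eq_sym.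
have: projv R (vsval u) \in (R :&: R^C)%VS.
  rewrite memv_cap memv_proj -[projv R _](subKr (vsval u)).
  by rewrite rpredB ?memv_projC.
by rewrite capv_compl memv0.
Qed.

Lemma quov_piP w : quov_repr (quov_pi w) - w \in R.
Proof. by rewrite -lker_quov_pi memv_ker linearB /= quov_reprK subrr. Qed.

Definition quov_end (f : 'End(W)) : 'End(quov) :=
  (quov_pi \o f \o quov_repr)%VF.

Lemma quov_endE f w :
  (f @: R <= R)%VS -> quov_end f (quov_pi w) = quov_pi (f w).
Proof.
move=> fR; rewrite !comp_lfunE /=; apply/eqP.
rewrite -subr_eq0 -!linearB /= -memv_ker lker_quov_pi.
by apply: (subvP fR); rewrite memv_img ?quov_piP.
Qed.

End Quotient.

(* Left kF-modules on a finite-dimensional space V, as linear actions of F;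
   the values outside F are irrelevant. *)
Record group_module (k : fieldType) (gT : finGroupType) (F : {group gT})
    (V : vectType k) := GroupModule {
  gm_op :> gT -> 'End(V);
  gm_op1 : gm_op 1%g = \1%VF;
  gm_opM : {in F &, forall x y, gm_op (x * y)%g = (gm_op x \o gm_op y)%VF}
}.

Section GroupModules.

Variables (k : fieldType) (gT : finGroupType) (F : {group gT}).
Variable (V : vectType k).

Definition simple_gm (M : group_module F V) : Prop :=
  ({:V} != 0)%VS /\
  forall U : {vspace V}, {in F, forall x, (M x @: U <= U)%VS} ->
    U = 0%VS \/ U = fullv.

Definition gm_char (M : group_module F V) (x : gT) : k := lftrace (M x).

Definition fs_indicator (chi : gT -> k) : k :=
  #|F|%:R^-1 * \sum_(z in F) chi (z ^+ 2)%g.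

End GroupModules.

Section Induction.

Variables (k : fieldType) (gT : finGroupType) (F K : {group gT}).
Variables (V : vectType k) (M : group_module K V).

(* kF (x)_k V: the function f stands for \sum_(y in F) y (x) f y. *)
Definition preind : Type := {ffun subg_of F -> V}.

HB.instance Definition _ := Vector.on preind.

Definition pretens (y : subg_of F) (v : V) : preind :=
  [ffun w => if w == y then v else 0].

Fact pretens_linear y : linear (pretens y).
Proof.
by move=> c u v; apply/ffunP=> w; rewrite !ffunE; case: ifP;
  rewrite ?scaler0 ?addr0.
Qed.

HB.instance Definition _ y :=
  GRing.isLinear.Build k V preind _ (pretens y) (pretens_linear y).

(* The span of all yz (x) v - y (x) zv with y in F, z in K and v in V
   (used only for K \subset F). *)
Definition ind_rel : {vspace preind} :=
  (\sum_(y : subg_of F) \sum_(z in K)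
     limg (linfun (pretens (y * subg F z)%g)
           - (linfun (pretens y) \o M z))%VF)%VS.

(* kF (x)_kK V *)
Definition ind_space := quov ind_rel.

HB.instance Definition _ := Vector.on ind_space.

Definition ind_tens (y : gT) (v : V) : ind_space :=
  quov_pi ind_rel (pretens (subg F y) v).

Definition preind_act_fun (x : gT) (f : preind) : preind :=
  [ffun w => f ((subg F x)^-1 * w)%g].

Fact preind_act_linear x : linear (preind_act_fun x).
Proof. by move=> c f h; apply/ffunP=> w; rewrite !ffunE. Qed.

HB.instance Definition _ x :=
  GRing.isLinear.Build k preind preind _ (preind_act_fun x)
    (preind_act_linear x).

Definition preind_act x : 'End(preind) := linfun (preind_act_fun x).

Definition ind_op (x : gT) : 'End(ind_space) := quov_end ind_rel (preind_act x).

Lemma preind_act_tens x y v :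
  preind_act x (pretens y v) = pretens (subg F x * y)%g v.
Proof.
rewrite lfunE /=; apply/ffunP=> w; rewrite !ffunE.
by rewrite -(inj_eq (mulgI (subg F x))) mulKVg.
Qed.

Lemma ind_rel_gen (y : subg_of F) z v : z \in K ->
  pretens (y * subg F z)%g v - pretens y (M z v) \in ind_rel.
Proof.
move=> Kz; have -> : pretens (y * subg F z)%g v - pretens y (M z v) =
  (linfun (pretens (y * subg F z)%g) - (linfun (pretens y) \o M z))%VF v.
  by rewrite add_lfunE opp_lfunE comp_lfunE !lfunE.
apply: (subvP _ _ (memv_img _ (memvf v))).
by rewrite /ind_rel (bigD1 y) //= (bigD1 z) //= -!addvA addvSl.
Qed.

Lemma ind_rel_stable (f : 'End(preind)) :
  (forall (y : subg_of F) z v, z \in K ->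
     f (pretens (y * subg F z)%g v - pretens y (M z v)) \in ind_rel) ->
  (f @: ind_rel <= ind_rel)%VS.
Proof.
move=> fR; rewrite {1}/ind_rel limg_sum; apply/subv_sumP=> y _.
rewrite limg_sum; apply/subv_sumP=> z Kz.
apply/subvP=> _ /memv_imgP[_ /memv_imgP[v _ ->] ->].
by rewrite add_lfunE opp_lfunE comp_lfunE !lfunE; apply: fR.
Qed.

Lemma preind_act_stable x : (preind_act x @: ind_rel <= ind_rel)%VS.
Proof.
apply: ind_rel_stable => y z v Kz.
by rewrite linearB /= !preind_act_tens mulgA ind_rel_gen.
Qed.

Lemma preind_sum (f : preind) : f = \sum_y pretens y (f y).
Proof.
apply/ffunP=> w; rewrite sum_ffunE (bigD1 w) //= ffunE eqxx.
by rewrite big1 ?addr0 // => y /negPf; rewrite ffunE eq_sym => ->.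
Qed.

Lemma ind_space_sum (u : ind_space) :
  exists f : gT -> V, u = \sum_(y in F) ind_tens y (f y).
Proof.
exists (fun y => quov_repr _ u (subg F y)).
rewrite -[LHS](quov_reprK u) [X in quov_pi _ X]preind_sum linear_sum /=.
rewrite [RHS](reindex_onto sgval (subg F)) /=; last first.
  by move=> y Fy; rewrite subgK.
apply: eq_big => [y|y _]; first by rewrite subgP sgvalK eqxx.
by rewrite /ind_tens sgvalK.
Qed.

Lemma ind_eqlfun (f h : 'End(ind_space)) :
  {in F, forall y v, f (ind_tens y v) = h (ind_tens y v)} -> f = h.
Proof.
move=> fh; apply/lfunP=> u; have [w ->] := ind_space_sum u.
by rewrite !linear_sum; apply: eq_bigr => y Fy; apply: fh.
Qed.

Lemma ind_tens_balanced y z v : K \subset F -> y \in F -> z \in K ->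
  ind_tens (y * z)%g v = ind_tens y (M z v).
Proof.
move=> sKF Fy Kz; apply/eqP; rewrite -subr_eq0 /ind_tens
  -linearB /= -memv_ker.
by rewrite lker_quov_pi (subgM Fy) ?ind_rel_gen ?(subsetP sKF).
Qed.

Lemma ind_op_tens x y v : x \in F -> y \in F ->
  ind_op x (ind_tens y v) = ind_tens (x * y)%g v.
Proof.
move=> Fx Fy; rewrite /ind_op quov_endE ?preind_act_stable //.
by rewrite preind_act_tens -subgM.
Qed.

Fact ind_op1 : ind_op 1%g = \1%VF.
Proof. by apply: ind_eqlfun => y Fy v; rewrite ind_op_tens // mul1g id_lfunE. Qed.

Fact ind_opM :
  {in F &, forall x y, ind_op (x * y)%g = (ind_op x \o ind_op y)%VF}.
Proof.
move=> x y Fx Fy; apply: ind_eqlfun => w Fw v.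
by rewrite [RHS]comp_lfunE !ind_op_tens ?groupM // mulgA.
Qed.

Definition ind_module : group_module F ind_space :=
  GroupModule ind_op1 ind_opM.

End Induction.

(* H = (kG)^* # kL, as the functions of coordinates on the basis p_g x; the
   action [a] only determines the multiplication. *)
Definition smash (k : fieldType) (gT lT : finGroupType)
  (a : left_aut_action lT gT) : Type := {ffun gT * lT -> k^o}.

Section SmashProduct.

Variables (k : fieldType) (gT lT : finGroupType) (a : left_aut_action lT gT).
Local Notation smash := (smash k a).

HB.instance Definition _ := Vector.on smash.

Definition pbasis (g : gT) (x : lT) : smash :=
  [ffun u => (u == (g, x))%:R : k^o].

Definition smash_mul (s t : smash) : smash :=
  \sum_(u : gT * lT) \sum_(v : gT * lT)
    (s u * t v) *:
      ((u.1 == a u.2 v.1)%:R *: pbasis u.1 (u.2 * v.2)%g).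

Definition smash_one : smash := \sum_(g : gT) pbasis g 1%g.

Lemma smash_mulE s t g x :
  smash_mul s t (g, x) =
  \sum_(y : lT) s (g, y) * t (a y^-1%g g, (y^-1 * x)%g).
Proof.
rewrite /smash_mul sum_ffunE.
rewrite (eq_bigr (fun u : gT * lT => if u.1 == g then
   s (u.1, u.2) * t (a u.2^-1%g u.1, (u.2^-1 * x)%g) else 0)); last first.
  case=> h y _ /=; rewrite sum_ffunE.
  rewrite (bigD1 (a y^-1%g h, (y^-1 * x)%g)) //= big1 ?addr0.
    rewrite !ffunE aut_actKV eqxx scale1r mulKVg xpair_eqE eqxx andbT eq_sym.
    by case: eqP; rewrite ?scaler0 // => _; apply: mulr1.
  case=> h' y' /= ne; rewrite !ffunE xpair_eqE.
  case: (h =P _) => [def_h|_]; last by rewrite scale0r scaler0.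
  rewrite scale1r; case: (x =P _) => [def_x|_]; last by rewrite andbF scaler0.
  by case/eqP: ne; rewrite def_h def_x aut_actK mulKg.
rewrite -(pair_bigA _ (fun h y => if h == g then
   s (h, y) * t (a y^-1%g h, (y^-1 * x)%g) else 0)) /=.
rewrite (bigD1 g) //= [X in _ + X]big1 ?addr0; last first.
  by move=> h /negPf->; rewrite big1.
by apply: eq_bigr => y _; rewrite eqxx.
Qed.

Lemma pbasis_sum (s : smash) : s = \sum_(u : gT * lT) s u *: pbasis u.1 u.2.
Proof.
apply/ffunP=> u; rewrite sum_ffunE (bigD1 u) //= !ffunE -surjective_pairing.
rewrite eqxx big1 ?addr0; first by rewrite [RHS]mulr1.
move=> v /negPf; rewrite !ffunE -surjective_pairing eq_sym => ->.
by rewrite scaler0.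
Qed.

Fact smash_mulA : associative smash_mul.
Proof.
move=> s t r; apply/ffunP=> -[g x]; rewrite !smash_mulE.
under eq_bigr => y _ do rewrite smash_mulE mulr_sumr.
under [RHS]eq_bigr => y _ do rewrite smash_mulE mulr_suml.
rewrite [RHS]exchange_big /=; apply: eq_bigr => y _.
rewrite [RHS](reindex_inj (mulgI y)) /=; apply: eq_bigr => z _.
by rewrite mulKg mulrA !invMg !mulgA aut_actM.
Qed.

Fact smash_oneE g x : smash_one (g, x) = (x == 1%g)%:R.
Proof.
rewrite sum_ffunE (bigD1 g) //= big1 ?addr0.
  by rewrite ffunE xpair_eqE eqxx.
by move=> h /negPf; rewrite ffunE xpair_eqE eq_sym => ->.
Qed.

Fact smash_mul1 : left_id smash_one smash_mul.
Proof.
move=> s; apply/ffunP=> -[g x]; rewrite smash_mulE (bigD1 1%g) //=.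
rewrite smash_oneE eqxx mul1r invg1 aut_act1 mul1g big1 ?addr0 //.
by move=> y /negPf; rewrite smash_oneE => ->; rewrite mul0r.
Qed.

Fact smash_mulr1 : right_id smash_one smash_mul.
Proof.
move=> s; apply/ffunP=> -[g x]; rewrite smash_mulE (bigD1 x) //=.
rewrite smash_oneE mulVg eqxx mulr1 big1 ?addr0 //.
by move=> y; rewrite eq_sym smash_oneE -eq_mulVg1 eq_sym => /negPf->;
  rewrite mulr0.
Qed.

Fact smash_mulDl : left_distributive smash_mul +%R.
Proof.
move=> s t r; apply/ffunP=> -[g x]; rewrite [RHS]ffunE !smash_mulE -big_split.
by apply: eq_bigr => y _; rewrite ffunE mulrDl.
Qed.

Fact smash_mulDr : right_distributive smash_mul +%R.
Proof.
move=> s t r; apply/ffunP=> -[g x]; rewrite [RHS]ffunE !smash_mulE -big_split.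
by apply: eq_bigr => y _; rewrite ffunE mulrDr.
Qed.

Fact smash_one_neq0 : smash_one != 0.
Proof.
apply/eqP=> /ffunP/(_ (1%g, 1%g)); rewrite smash_oneE ffunE eqxx.
by move/eqP; rewrite oner_eq0.
Qed.

HB.instance Definition _ := GRing.Zmodule_isNzRing.Build smash
  smash_mulA smash_mul1 smash_mulr1 smash_mulDl smash_mulDr smash_one_neq0.

Fact smash_scalerAl (c : k) (s t : smash) : c *: (s * t) = (c *: s) * t.
Proof.
apply/ffunP=> -[g x]; rewrite ffunE !smash_mulE scaler_sumr.
by apply: eq_bigr => y _; rewrite ffunE scalerAl.
Qed.

HB.instance Definition _ :=
  GRing.Lmodule_isLalgebra.Build k smash smash_scalerAl.

Fact smash_scalerAr (c : k) (s t : smash) : c *: (s * t) = s * (c *: t).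
Proof.
apply/ffunP=> -[g x]; rewrite ffunE !smash_mulE scaler_sumr.
by apply: eq_bigr => y _; rewrite ffunE scalerAr.
Qed.

HB.instance Definition _ :=
  GRing.Lalgebra_isAlgebra.Build k smash smash_scalerAr.

HB.instance Definition _ := Algebra_isFalgebra.Build k smash.

End SmashProduct.

(* Left modules over a k-algebra on a finite-dimensional space W. *)
Record alg_module (k : fieldType) (A : falgType k) (W : vectType k) :=
  AlgModule {
    am_op :> {linear A -> 'End(W)};
    am_op1 : am_op 1 = \1%VF;
    am_opM : forall s t, am_op (s * t) = (am_op s \o am_op t)%VF
  }.

Definition am_char (k : fieldType) (A : falgType k) (W : vectType k)
  (M : alg_module A W) (s : A) : k := lftrace (M s).

Section HopfStructure.

Variables (k : fieldType) (gT lT : finGroupType) (a : left_aut_action lT gT).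
Local Notation H := (smash k a).
Local Notation p := (pbasis k a).

Lemma smash_mulrE (s t : H) g x :
  (s * t) (g, x) = \sum_(y : lT) s (g, y) * t (a y^-1%g g, (y^-1 * x)%g).
Proof. exact: smash_mulE. Qed.

Lemma pbasisM g x h y :
  p g x * p h y = (g == a x h)%:R *: p g (x * y)%g.
Proof.
apply/ffunP=> -[g' x']; rewrite [LHS]smash_mulE ffunE (bigD1 x) //=.
rewrite big1 ?addr0 => [|z /negPf ne]; last first.
  by rewrite !ffunE xpair_eqE ne andbF mul0r.
rewrite !ffunE !xpair_eqE eqxx andbT -(inj_eq (mulgI x) (_ * _)%g) mulKVg.
case: (g' =P g) => [->|_]; last by rewrite mul0r scaler0.
rewrite mul1r -(inj_eq (can_inj (aut_actK a x)) _ h) aut_actKV.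
by case: (g == _); rewrite ?scale0r ?scale1r.
Qed.

(* H (x) H, as the functions of coordinates on the basis p_g x (x) p_h y. *)
Definition smash2 : Type := {ffun (gT * lT) * (gT * lT) -> k^o}.

HB.instance Definition _ := Vector.on smash2.

Definition tens (s t : H) : smash2 := [ffun w => s w.1 * t w.2 : k^o].

Definition smash2_mul (S T : smash2) : smash2 :=
  \sum_u \sum_v (S u * T v) *:
    tens (p u.1.1 u.1.2 * p v.1.1 v.1.2) (p u.2.1 u.2.2 * p v.2.1 v.2.2).

(* The multiplication map H (x) H -> H. *)
Definition tens_mul (S : smash2) : H :=
  \sum_u S u *: (p u.1.1 u.1.2 * p u.2.1 u.2.2).

Definition comul (s : H) : smash2 :=
  \sum_(u : gT * lT)
    s u *: \sum_(h : gT) tens (p h u.2) (p (h^-1 * u.1)%g u.2).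

Definition counit (s : H) : k :=
  \sum_(u : gT * lT) s u * (u.1 == 1%g)%:R.

Definition antipode (s : H) : H :=
  \sum_(u : gT * lT) s u *: p (a u.2^-1%g u.1^-1%g) u.2^-1%g.

Definition hopf_integral (Lam : H) : Prop :=
  forall s : H, s * Lam = counit s *: Lam /\ Lam * s = counit s *: Lam.

(* Lam^[2] *)
Definition sweedler_square (Lam : H) : H := tens_mul (comul Lam).

Definition schur_indicator (Lam : H) (chi : H -> k) : k :=
  chi (sweedler_square Lam).

Lemma comulE (s : H) h x h' y :
  comul s ((h, x), (h', y)) = if x == y then s ((h * h')%g, x) else 0.
Proof.
rewrite sum_ffunE (bigD1 ((h * h')%g, x)) //= [X in _ + X]big1 ?addr0; last first.
  case=> g z /= ne; rewrite ffunE sum_ffunE big1 ?scaler0 // => h1 _.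
  rewrite !ffunE /= !xpair_eqE; case: (h =P h1) => [<-|_]; last by rewrite mul0r.
  case: (x =P z) => [xz|_]; last by rewrite mul0r.
  case: (h' =P _) => [h'g|_]; last by rewrite mulr0.
  by move: ne; rewrite h'g mulKVg xz !xpair_eqE !eqxx.
rewrite ffunE sum_ffunE (bigD1 h) //= big1 ?addr0 => [|h1 /negPf ne]; last first.
  by rewrite !ffunE /= xpair_eqE eq_sym ne mul0r.
rewrite !ffunE /= !xpair_eqE !eqxx mulKg eqxx mul1r eq_sym.
by case: (x == y); rewrite /= ?scaler0 //; apply: mulr1.
Qed.

Lemma tensE (s t : H) u v : tens s t (u, v) = s u * t v.
Proof. by rewrite ffunE. Qed.

Lemma pbasisE g x u : p g x u = (u == (g, x))%:R.
Proof. by rewrite ffunE. Qed.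

Lemma counitE (s : H) : counit s = \sum_(x : lT) s (1%g, x).
Proof.
rewrite /counit (eq_bigr (fun u => s (u.1, u.2) * (u.1 == 1%g)%:R)); last first.
  by case.
rewrite -(pair_bigA _ (fun h y => s (h, y) * (h == 1%g)%:R)) /=.
rewrite (bigD1 1%g) //= [X in _ + X]big1 ?addr0; last first.
  by move=> h /negPf->; rewrite big1 // => x _; rewrite mulr0.
by apply: eq_bigr => x _; rewrite eqxx mulr1.
Qed.

Lemma counitM (s t : H) : counit (s * t) = counit s * counit t.
Proof.
rewrite !counitE; under eq_bigr => x _ do rewrite smash_mulE.
rewrite exchange_big mulr_suml; apply: eq_bigr => y _ /=.
rewrite mulr_sumr [LHS](reindex_inj (mulgI y)) /=; apply: eq_bigr => x _.
by rewrite mulKg aut_act_one.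
Qed.

Lemma counit1 : counit 1 = 1.
Proof.
rewrite counitE (bigD1 1%g) //= smash_oneE eqxx big1 ?addr0 //.
by move=> x /negPf; rewrite smash_oneE => ->.
Qed.

Lemma comul1 : comul 1 = tens 1 1.
Proof.
apply/ffunP=> -[[g x] [h y]]; rewrite comulE tensE !smash_oneE eq_sym.
case: (x =P 1%g) => [->|_]; last by rewrite mul0r; case: ifP.
by rewrite mul1r; case: (y == 1%g).
Qed.

Lemma comul_coassoc (s : H) u v w :
  \sum_z comul s (z, w) * comul (p z.1 z.2) (u, v) =
  \sum_z comul s (u, z) * comul (p z.1 z.2) (v, w).
Proof.
case: u v w => [g x] [h y] [l z].
rewrite (bigD1 ((g * h)%g, x)) //= [X in _ + X]big1 ?addr0; last first.
  move=> [g' x'] /= /negPf ne; rewrite [X in _ * X]comulE pbasisE [(_, _) == _]eq_sym ne.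
  by rewrite if_same mulr0.
rewrite (bigD1 ((h * l)%g, y)) //= [X in _ = _ + X]big1 ?addr0; last first.
  move=> [g' x'] /= /negPf ne; rewrite [X in _ * X]comulE pbasisE [(_, _) == _]eq_sym ne.
  by rewrite if_same mulr0.
rewrite !comulE !pbasisE !eqxx mulgA.
case: (x =P y) => [->|_]; last by rewrite mulr0 mul0r.
by rewrite mulr1; case: eqP; rewrite (mulr1, mulr0).
Qed.

Lemma comul_counitl (s : H) u : \sum_v counit (p v.1 v.2) * comul s (v, u) = s u.
Proof.
case: u => g x; rewrite (bigD1 (1%g, x)) //= [X in _ + X]big1 ?addr0.
  rewrite comulE eqxx mul1g counitE (bigD1 x) //= pbasisE eqxx.
  rewrite big1 ?addr0 ?mul1r // => y /negPf ne.
  by rewrite pbasisE xpair_eqE ne andbF.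
case=> h y /= ne; rewrite comulE counitE; case: (y =P x) => [yx|_]; last first.
  by rewrite mulr0.
rewrite big1 ?mul0r // => z _; rewrite pbasisE xpair_eqE.
by move: ne; rewrite yx xpair_eqE eqxx andbT eq_sym => /negPf->.
Qed.

Lemma comul_counitr (s : H) u : \sum_v comul s (u, v) * counit (p v.1 v.2) = s u.
Proof.
case: u => g x; rewrite (bigD1 (1%g, x)) //= [X in _ + X]big1 ?addr0.
  rewrite comulE eqxx mulg1 counitE (bigD1 x) //= pbasisE eqxx.
  rewrite big1 ?addr0 ?mulr1 // => y /negPf ne.
  by rewrite pbasisE xpair_eqE ne andbF.
case=> h y /= ne; rewrite comulE counitE; case: (x =P y) => [yx|_]; last first.
  by rewrite mul0r.
rewrite big1 ?mulr0 // => z _; rewrite pbasisE xpair_eqE.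
by move: ne; rewrite yx xpair_eqE eqxx andbT eq_sym => /negPf->.
Qed.

Lemma smash2_coord (S : smash2) u :
  S u = \sum_w S w * (p w.1.1 w.1.2 u.1 * p w.2.1 w.2.2 u.2).
Proof.
case: u => -[g x] [h y]; rewrite (bigD1 ((g, x), (h, y))) //= !pbasisE !eqxx.
rewrite !mulr1 big1 ?addr0 // => -[[g' x'] [h' y']] /=; rewrite !pbasisE /=.
rewrite xpair_eqE eq_sym [X in _ && X]eq_sym negb_and.
by case/orP=> /negPf->; rewrite ?mul0r ?mulr0.
Qed.

Lemma smash2_mulE (S T : smash2) g x h y :
  smash2_mul S T ((g, x), (h, y)) =
  \sum_z \sum_w S ((g, z), (h, w)) *
    T ((a z^-1%g g, (z^-1 * x)%g), (a w^-1%g h, (w^-1 * y)%g)).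
Proof.
under [RHS]eq_bigr => z _.
  under eq_bigr => w _.
    rewrite [X in X * _]smash2_coord [X in _ * X]smash2_coord mulr_suml.
    under eq_bigr => u _ do rewrite mulr_sumr.
    over.
  rewrite exchange_big /=.
  under eq_bigr => u _ do rewrite exchange_big /=.
  over.
rewrite [RHS]exchange_big sum_ffunE /=; apply: eq_bigr => u _.
rewrite [RHS]exchange_big sum_ffunE /=; apply: eq_bigr => v _.
rewrite ffunE tensE !smash_mulrE [X in _ *: X]mulr_suml scaler_sumr.
apply: eq_bigr => z _; rewrite [X in _ *: X]mulr_sumr scaler_sumr.
apply: eq_bigr => w _; rewrite /GRing.scale /=.
by rewrite [RHS]mulrACA [X in _ = _ * X]mulrACA.
Qed.

Lemma comulM (s t : H) : comul (s * t) = smash2_mul (comul s) (comul t).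
Proof.
apply/ffunP=> -[[g x] [h y]]; rewrite smash2_mulE comulE.
under [RHS]eq_bigr => z _.
  rewrite (bigD1 z) //= big1 ?addr0; last first.
    by move=> w /negPf; rewrite eq_sym comulE => ->; rewrite mul0r.
  rewrite !comulE eqxx (inj_eq (mulgI _)) -aut_act_morph.
  over.
case: (x == y); last by rewrite big1 // => z _; rewrite mulr0.
by rewrite [LHS]smash_mulE.
Qed.

Lemma antipode_pbasis g x : antipode (p g x) = p (a x^-1%g g^-1%g) x^-1%g.
Proof.
rewrite /antipode (bigD1 (g, x)) //= pbasisE eqxx scale1r big1 ?addr0 // => u.
by rewrite pbasisE => /negPf->; rewrite scale0r.
Qed.

Lemma antipode_l (s : H) :
  \sum_u \sum_v comul s (u, v) *: (antipode (p u.1 u.2) * p v.1 v.2) =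
  counit s *: 1 :> H.
Proof.
pose F h x := \sum_v comul s ((h, x), v) *: (antipode (p h x) * p v.1 v.2).
rewrite (eq_bigr (fun u => F u.1 u.2)); last by case.
rewrite -(pair_bigA _ F) /F /= exchange_big counitE scaler_suml /=.
apply: eq_bigr => x _; rewrite [1]/(smash_one k a) scaler_sumr.
rewrite (reindex_inj (can_inj (aut_actK a x))) (reindex_inj invg_inj) /=.
apply: eq_bigr => h _; rewrite (bigD1 ((a x h^-1%g)^-1%g, x)) //=.
rewrite big1 ?addr0.
  rewrite comulE eqxx mulgV antipode_pbasis pbasisM -!aut_actV invgK aut_actK.
  by rewrite eqxx mulVg scale1r.
case=> h' y /= ne; rewrite comulE; case: (x =P y) => [yx|_]; last first.
  by rewrite scale0r.
rewrite antipode_pbasis pbasisM (inj_eq (can_inj (aut_actK a _))).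
by move: ne; rewrite yx xpair_eqE eqxx andbT eq_sym => /negPf->;
  rewrite scale0r scaler0.
Qed.

Lemma antipode_r (s : H) :
  \sum_u \sum_v comul s (u, v) *: (p u.1 u.2 * antipode (p v.1 v.2)) =
  counit s *: 1 :> H.
Proof.
pose F h x := \sum_v comul s ((h, x), v) *: (p h x * antipode (p v.1 v.2)).
rewrite (eq_bigr (fun u => F u.1 u.2)); last by case.
rewrite -(pair_bigA _ F) /F /= exchange_big counitE scaler_suml /=.
apply: eq_bigr => x _; rewrite [1]/(smash_one k a) scaler_sumr.
apply: eq_bigr => h _; rewrite (bigD1 (h^-1%g, x)) //= big1 ?addr0.
  rewrite comulE eqxx mulgV antipode_pbasis pbasisM invgK aut_actKV.
  by rewrite eqxx mulgV scale1r.
case=> h' y /= ne; rewrite comulE; case: (x =P y) => [yx|_]; last first.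
  by rewrite scale0r.
rewrite antipode_pbasis pbasisM yx aut_actKV.
rewrite -(inj_eq invg_inj h) invgK eq_sym.
by move: ne; rewrite yx xpair_eqE eqxx andbT => /negPf->;
  rewrite scale0r scaler0.
Qed.

Definition std_integral : H := #|lT|%:R^-1 *: \sum_(x : lT) p 1%g x.

Lemma std_integralE g x : std_integral (g, x) = #|lT|%:R^-1 * (g == 1%g)%:R.
Proof.
rewrite ffunE sum_ffunE (bigD1 x) //= pbasisE xpair_eqE eqxx andbT.
rewrite big1 ?addr0 // => y /negPf ne.
by rewrite pbasisE xpair_eqE eq_sym [x == y]eq_sym ne andbF.
Qed.

Lemma std_integralP : hopf_integral std_integral.
Proof.
have act_eq1 y h : (a y h == 1%g) = (h == 1%g).
  by rewrite -(inj_eq (can_inj (aut_actK a y)) h) aut_act_one.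
move=> s; split; apply/ffunP=> -[g x]; rewrite [LHS]smash_mulE counitE ffunE.
  rewrite std_integralE; have [->|ng] := eqVneq g 1%g; last first.
    rewrite mulr0 scaler0 big1 // => y _.
    by rewrite std_integralE act_eq1 (negPf ng) !mulr0.
  rewrite scaler_suml; apply: eq_bigr => y _.
  by rewrite std_integralE act_eq1 eqxx.
rewrite std_integralE; have [->|ng] := eqVneq g 1%g; last first.
  rewrite mulr0 scaler0 big1 // => y _.
  by rewrite std_integralE (negPf ng) mulr0 mul0r.
rewrite scaler_suml (reindex_inj invg_inj) (reindex_inj (mulIg x^-1%g)) /=.
apply: eq_bigr => y _; rewrite std_integralE eqxx mulr1 mulrC.
by rewrite invgK mulgKV aut_act_one.
Qed.

Lemma counit_std_integral : #|lT|%:R != 0 :> k -> counit std_integral = 1.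
Proof.
move=> nz; rewrite counitE.
under eq_bigr => x _ do rewrite std_integralE eqxx mulr1.
by rewrite sumr_const -[LHS]mulr_natr; apply: mulVf.
Qed.

Lemma integral_unique (Lam Lam' : H) :
  hopf_integral Lam -> counit Lam = 1 ->
  hopf_integral Lam' -> counit Lam' = 1 -> Lam = Lam'.
Proof.
move=> intL eL intL' eL'; have [_] := intL Lam'; rewrite eL' scale1r => <-.
by have [-> _] := intL' Lam; rewrite eL scale1r.
Qed.

End HopfStructure.

Section InducedSmashModule.

Variables (k : fieldType) (gT lT : finGroupType) (a : left_aut_action lT gT).
Variables (g : gT) (V : vectType k) (M : group_module (stab_group a g) V).

Local Notation L := [set: lT]%G.

(* y (x) v |-> delta_(y.g, h) y (x) v on kL (x)_k V *)
Definition preind_proj_fun (h : gT) (f : preind L V) : preind L V :=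
  [ffun w => if a (sgval w) g == h then f w else 0].

Fact preind_proj_linear h : linear (preind_proj_fun h).
Proof.
by move=> c u v; apply/ffunP=> w; rewrite !ffunE; case: ifP;
  rewrite ?scaler0 ?addr0.
Qed.

HB.instance Definition _ h :=
  GRing.isLinear.Build k (preind L V) (preind L V) _ (preind_proj_fun h)
    (preind_proj_linear h).

Definition preind_proj h : 'End(preind L V) := linfun (preind_proj_fun h).

(* The underlying space of V^ = kL (x)_(kL_g) V *)
Definition hat_space := ind_space L M.

HB.instance Definition _ := Vector.on hat_space.

(* The operator of p_h x *)
Definition hat_basis_op (h : gT) (x : lT) : 'End(hat_space) :=
  quov_end (ind_rel L M) (preind_proj h \o preind_act L V x)%VF.

Definition hat_op (s : smash k a) : 'End(hat_space) :=
  \sum_(u : gT * lT) s u *: hat_basis_op u.1 u.2.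

Fact hat_op_linear : linear hat_op.
Proof.
move=> c s t; rewrite /hat_op scaler_sumr -big_split; apply: eq_bigr => u _ /=.
by rewrite !ffunE scalerDl scalerA.
Qed.

HB.instance Definition _ :=
  GRing.isLinear.Build k (smash k a) 'End(hat_space) _ hat_op hat_op_linear.

Lemma preind_proj_tens h (y : subg_of L) (v : V) :
  preind_proj h (pretens y v) =
  (a (sgval y) g == h)%:R *: pretens y v.
Proof.
rewrite lfunE; apply/ffunP=> w; rewrite !ffunE.
case: (w =P y) => [->|_]; last by rewrite if_same scaler0.
by case: ifP; rewrite ?scale1r ?scale0r.
Qed.

Lemma preind_op_stable h x :
  ((preind_proj h \o preind_act L V x) @: ind_rel L M <= ind_rel L M)%VS.
Proof.
apply: ind_rel_stable => y z v Kz; rewrite comp_lfunE linearB /=.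
rewrite !preind_act_tens linearB /= !preind_proj_tens mulgA /=.
have -> : a (sgval (subg L x) * sgval y * sgval (subg L z))%g g =
          a (sgval (subg L x) * sgval y)%g g.
  rewrite [LHS]aut_actM (@subgK _ L z (in_setT z)).
  by move: Kz; rewrite inE => /eqP->.
by rewrite -scalerBr rpredZ ?ind_rel_gen.
Qed.

Lemma hat_basis_op_tens h x y v :
  hat_basis_op h x (ind_tens L M y v) =
  (a (x * y)%g g == h)%:R *: ind_tens L M (x * y)%g v.
Proof.
rewrite /hat_basis_op quov_endE ?preind_op_stable // comp_lfunE.
rewrite preind_act_tens preind_proj_tens linearZ /= -subgM ?inE //.
by rewrite !(@subgK _ L _ (in_setT _)).
Qed.

Lemma hat_op_pbasis h x : hat_op (pbasis k a h x) = hat_basis_op h x.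
Proof.
rewrite /hat_op (bigD1 (h, x)) //= pbasisE eqxx scale1r big1 ?addr0 // => u.
by rewrite pbasisE => /negPf->; rewrite scale0r.
Qed.

Fact hat_op1 : hat_op 1 = \1%VF.
Proof.
apply: ind_eqlfun => y Fy v; rewrite id_lfunE [1]/(smash_one k a) linear_sum.
rewrite sum_lfunE (bigD1 (a y g)) //= hat_op_pbasis hat_basis_op_tens mul1g.
rewrite eqxx scale1r big1 ?addr0 // => h /negPf ne.
by rewrite hat_op_pbasis hat_basis_op_tens mul1g eq_sym ne scale0r.
Qed.

Fact hat_opM s t : hat_op (s * t) = (hat_op s \o hat_op t)%VF.
Proof.
apply: ind_eqlfun => y Fy v; rewrite [RHS]comp_lfunE.
rewrite [in LHS](pbasis_sum s) [in LHS](pbasis_sum t) mulr_suml linear_sum /=.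
rewrite [hat_op s]/hat_op !sum_lfunE; apply: eq_bigr => u _.
rewrite mulr_sumr linear_sum !sum_lfunE linear_sum /=.
apply: eq_bigr => w _; rewrite -scalerAl -scalerAr pbasisM !linearZ /=.
rewrite hat_op_pbasis !scale_lfunE !hat_basis_op_tens !linearZ /=.
rewrite hat_basis_op_tens !mulgA !scalerA; congr (_ *: _).
rewrite [RHS]mulrAC -!mulrA; congr (_ * _); rewrite !mulrA; congr (_ * _).
rewrite -!natrM !mulnb.
congr (nat_of_bool _)%:R; rewrite -mulgA (aut_actM a u.2).
case: (a u.2 _ =P u.1) => [<-|_]; last by rewrite !andbF.
by rewrite (inj_eq (can_inj (aut_actK a u.2))).
Qed.

Definition hat_module : alg_module (smash k a) hat_space :=
  @AlgModule k (smash k a) hat_space hat_op hat_op1 hat_opM.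

(* nu_g of the character of M *)
Definition local_indicator : k :=
  let nu := fs_indicator (stab_group a g) (gm_char M) in
  if (g ^+ 2 == 1)%g then nu
  else fs_indicator (ext_stab_group a g)
         (gm_char (ind_module (ext_stab_group a g) M)) - nu.

End InducedSmashModule.

(* Main.v *)
(* By uniqueness the integral is 1/|L| sum_x p_1 x, whose Sweedler square is
   1/|L| sum_(x, h) delta_(h, x.h^-1) p_h x^2.  The trace formula for induced
   modules gives the value of the character of V^ on each p_h x^2, and
   conjugating x by the coset representative y collapses the sum to
   1/|L_g| sum of chi(x^2) over the x with x.g = g^-1.  Squares of elements of
   the extended stabilizer L~_g lie in L_g, so the same trace formula turns the
   indicator of Ind V over L~_g into 1/|L_g| sum of chi(z^2) over z in L~_g;
   when g^2 <> 1, L~_g is the disjoint union of L_g and the x above. *)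

From HB Require Import structures.
Require Import Defs.
From mathcomp Require Import all_boot all_algebra all_fingroup all_field.

Import GRing.Theory passmx.
Local Open Scope ring_scope.

Set Implicit Arguments.
Unset Strict Implicit.
Unset Printing Implicit Defensive.

(** * Traces of endomorphisms and linearity of characters *)

Section LinearTrace.

Variable k : fieldType.
Implicit Types U V W : vectType k.

Lemma lftraceD V (f h : 'End(V)) : lftrace (f + h) = lftrace f + lftrace h.
Proof. by rewrite /lftrace linearD /= mxtraceD. Qed.

Lemma lftraceZ V c (f : 'End(V)) : lftrace (c *: f) = c * lftrace f.
Proof. by rewrite /lftrace linearZ /= mxtraceZ. Qed.

Lemma lftrace0 V : lftrace (0 : 'End(V)) = 0.
Proof. by rewrite /lftrace linear0 mxtrace0. Qed.

Lemma lftrace_sum V (I : Type) (r : seq I) (P : pred I) (F : I -> 'End(V)) :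
  lftrace (\sum_(i <- r | P i) F i) = \sum_(i <- r | P i) lftrace (F i).
Proof. exact: (big_morph _ (@lftraceD V) (lftrace0 V)). Qed.

Lemma lftrace_comp V W (f : 'Hom(V, W)) (h : 'Hom(W, V)) :
  lftrace (f \o h)%VF = lftrace (h \o f)%VF.
Proof.
rewrite /lftrace (mxof_comp _ _ (vbasisP {:V})) (mxof_comp _ _ (vbasisP {:W})).
exact: mxtrace_mulC.
Qed.

Section AlgebraCharacter.

Variables (A : falgType k) (W : vectType k) (N : alg_module A W).

Lemma am_charZ c s : am_char N (c *: s) = c * am_char N s.
Proof. by rewrite /am_char linearZ lftraceZ. Qed.

Lemma am_char_sum (I : Type) (r : seq I) (P : pred I) (F : I -> A) :
  am_char N (\sum_(i <- r | P i) F i) = \sum_(i <- r | P i) am_char N (F i).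
Proof. by rewrite /am_char linear_sum lftrace_sum. Qed.

End AlgebraCharacter.

End LinearTrace.

(** * A trace formula on induced modules *)

Section InducedTrace.

Variables (k : fieldType) (gT : finGroupType) (F K : {group gT}).
Variables (V : vectType k) (M : group_module K V).

Definition preind_coord_fun (y : subg_of F) (f : preind F V) : V := f y.

Fact preind_coord_linear y : linear (preind_coord_fun y).
Proof. by move=> c f h; rewrite /preind_coord_fun !ffunE. Qed.

HB.instance Definition _ y :=
  GRing.isLinear.Build k (preind F V) V _ (preind_coord_fun y)
    (preind_coord_linear y).

Definition preind_coord y : 'Hom(preind F V, V) := linfun (preind_coord_fun y).

Definition pretens_hom (y : subg_of F) : 'Hom(V, preind F V) :=
  linfun (pretens y).

(** kF (x) V is a direct sum of copies of V indexed by F, so the trace is the sum of the traces of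
    the diagonal blocks. *)
Lemma lftrace_preind (f : 'End(preind F V)) :
  lftrace f = \sum_y lftrace (preind_coord y \o (f \o pretens_hom y))%VF.
Proof.
have deff : f = \sum_y ((f \o pretens_hom y) \o preind_coord y)%VF.
  apply/lfunP=> u; rewrite sum_lfunE {1}[u]preind_sum linear_sum.
  by apply: eq_bigr => y _; rewrite !comp_lfunE !lfunE.
rewrite {1}deff lftrace_sum; apply: eq_bigr => y _.
exact: lftrace_comp.
Qed.

(* Averaging over K kills the relations, and hence splits the projection of
   kF (x) V onto the induced module: this reduces traces on the quotient to
   traces on kF (x) V. *)
Definition preind_avg_fun (f : preind F V) : preind F V :=
  [ffun w => #|K|%:R^-1 *: \sum_(z in K) M z (f (w * subg F z)%g)].

Fact preind_avg_linear : linear preind_avg_fun.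
Proof.
move=> c f h; apply/ffunP=> w; rewrite !ffunE scalerA mulrC -scalerA -scalerDr.
congr (_ *: _); rewrite scaler_sumr -big_split; apply: eq_bigr => z _.
by rewrite !ffunE linearP.
Qed.

HB.instance Definition _ :=
  GRing.isLinear.Build k (preind F V) (preind F V) _ preind_avg_fun
    preind_avg_linear.

Definition preind_avg : 'End(preind F V) := linfun preind_avg_fun.

Lemma preind_avg_tens (y : subg_of F) v :
  preind_avg (pretens y v) =
  #|K|%:R^-1 *: \sum_(z in K) pretens (y * (subg F z)^-1)%g (M z v).
Proof.
apply/ffunP=> w; rewrite lfunE !ffunE; congr (_ *: _).
rewrite sum_ffunE; apply: eq_bigr => z _; rewrite !ffunE.
rewrite -(inj_eq (mulIg (subg F z)) w) mulgKV.
by case: eqP => // _; rewrite linear0.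
Qed.

Hypotheses (sKF : K \subset F) (nzK : #|K|%:R != 0 :> k).

Lemma preind_avg_rel (f : preind F V) : f \in ind_rel F M -> preind_avg f = 0.
Proof.
suff: (ind_rel F M <= lker preind_avg)%VS.
  by move=> /subvP sR /sR; rewrite memv_ker => /eqP.
apply/subv_sumP=> y _; apply/subv_sumP=> z Kz.
apply/subvP=> _ /memv_imgP[v _ ->]; rewrite memv_ker.
rewrite add_lfunE opp_lfunE comp_lfunE ![linfun (pretens _) _]lfunE linearB /=.
rewrite !preind_avg_tens subr_eq0; apply/eqP; congr (_ *: _).
(* Since yz(tz)^-1 = yt^-1, the shift t -> tz turns the average of yz (x) v into that of y (x)
   zv. *)
rewrite (reindex_inj (mulIg z)) /=; apply: eq_big => [t|t].
  by rewrite groupMr.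
rewrite groupMr // => Kt.
have [Ft Fz] : t \in F /\ z \in F by split; apply: (subsetP sKF).
by rewrite gm_opM // comp_lfunE subgM // invMg mulgA mulgK.
Qed.

(** Each of the |K| terms yz^-1 (x) zv in the average is congruent to y (x) v modulo the
    relations. *)
Lemma quov_pi_avg (f : preind F V) :
  quov_pi (ind_rel F M) (preind_avg f) = quov_pi (ind_rel F M) f.
Proof.
rewrite [f]preind_sum !linear_sum; apply: eq_bigr => y _ /=.
rewrite preind_avg_tens linearZ linear_sum /=.
rewrite (eq_bigr (fun=> quov_pi (ind_rel F M) (pretens y (f y)))).
  by rewrite sumr_const -scaler_nat scalerA mulVf // scale1r.
move=> z Kz; apply/eqP; rewrite eq_sym -subr_eq0 -linearB /= -memv_ker.
by rewrite lker_quov_pi -{1}(mulgKV (subg F z) y) ind_rel_gen.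
Qed.

(** Averaging yields a section [j] of the projection [pi], so T = pi j T and tr T = tr (j T pi),
    which is computed blockwise on kF (x) V. The weight [c] covers both group elements (c = 1) and
    the elements p_h x of H (c a delta). *)
Lemma lftrace_ind (T : 'End(ind_space F M)) (c : gT -> k) x : x \in F ->
    (forall y v, y \in F ->
       T (ind_tens F M y v) = c y *: ind_tens F M (x * y)%g v) ->
  lftrace T =
  #|K|%:R^-1 * \sum_(y in F | (x ^ y)%g \in K) c y * gm_char M (x ^ y)%g.
Proof.
move=> Fx defT.
pose pi : 'Hom(preind F V, ind_space F M) := quov_pi (ind_rel F M).
pose j : 'Hom(ind_space F M, preind F V) :=
  (preind_avg \o quov_repr (ind_rel F M))%VF.
have jpi f : j (pi f) = preind_avg f.
  rewrite comp_lfunE; apply/eqP.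
  by rewrite -subr_eq0 -linearB /= preind_avg_rel ?quov_piP.
have -> : T = (pi \o (j \o T))%VF.
  apply/lfunP=> u; rewrite !comp_lfunE /= quov_pi_avg.
  by rewrite [RHS]quov_reprK.
rewrite lftrace_comp lftrace_preind (reindex_onto (subg F) sgval) /=.
  2: by move=> y _; rewrite sgvalK.
rewrite (eq_bigl (mem F)); last first.
  move=> y; apply/eqP/idP=> [<-|/subgK//]; exact: subgP.
rewrite mulr_sumr big_mkcondr; apply: eq_bigr => y Fy.
set f := (_ \o _)%VF.
have -> : f = (if (x ^ y)%g \in K
    then (#|K|%:R^-1 * c y) *: M (x ^ y)%g else 0)%VF.
  apply/lfunP=> v; rewrite !comp_lfunE [pretens_hom _ _]lfunE.
  have -> : pi (pretens (subg F y) v) = ind_tens F M y v by [].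
  rewrite defT // !linearZ /=.
  have -> : ind_tens F M (x * y)%g v = pi (pretens (subg F (x * y)%g) v) by [].
  have := jpi (pretens (subg F (x * y)%g) v).
  rewrite /j comp_lfunE => ->; rewrite preind_avg_tens linearZ /= linear_sum.
  (* The term xyz^-1 (x) zv of the average has a component at y only if z = y^-1 x y. *)
  rewrite (eq_bigr (fun z => if z == (x ^ y)%g then M z v else 0)); last first.
    move=> z Kz; rewrite [LHS]lfunE /= /preind_coord_fun ffunE.
    rewrite -(inj_eq (mulIg (subg F z))) mulgKV.
    have Fz := subsetP sKF z Kz.
    rewrite -subgM // (inj_in_eq (can_in_inj (@subgK _ F))) ?groupM //.
    by rewrite conjgE -(inj_eq (mulgI y) z) mulKVg.
  rewrite -big_mkcondr /=; case: ifP => Kxy.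
    rewrite (big_pred1 (x ^ y)%g) => [|z /=].
      by rewrite scale_lfunE scalerA mulrC.
    by case: eqP => [->|]; rewrite ?andbF ?Kxy.
  rewrite big_pred0 ?zero_lfunE ?scaler0 // => z.
  by case: eqP => [->|]; rewrite ?andbF ?Kxy.
by case: ifP => _; rewrite ?lftrace0 ?lftraceZ ?mulr0 // mulrA.
Qed.

End InducedTrace.

(** * Characters and indicators of induced group modules *)

Lemma gm_char_ind (k : fieldType) (gT : finGroupType)
    (F K : {group gT}) (V : vectType k) (M : group_module K V) x :
    K \subset F -> #|K|%:R != 0 :> k -> x \in F ->
  gm_char (ind_module F M) x =
  #|K|%:R^-1 * \sum_(y in F | (x ^ y)%g \in K) gm_char M (x ^ y)%g.
Proof.
move=> sKF nzK Fx; rewrite /gm_char.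
rewrite (@lftrace_ind _ _ _ _ _ _ _ _ _ (fun=> 1) x) //.
  by congr (_ * _); apply: eq_bigr => y _; rewrite mul1r.
by move=> y v Fy; rewrite scale1r [LHS]ind_op_tens.
Qed.

(** In the induced character formula at z^2 the membership condition is automatic. Conjugation by y
    permutes F, so all |F| values of y contribute equally and cancel |F|^-1. *)
Lemma fs_indicator_ind (k : fieldType) (gT : finGroupType)
    (F K : {group gT}) (V : vectType k) (M : group_module K V) :
    K \subset F -> #|F|%:R != 0 :> k -> #|K|%:R != 0 :> k ->
    {in F, forall z, (z ^+ 2)%g \in K} ->
  fs_indicator F (gm_char (ind_module F M)) =
  #|K|%:R^-1 * \sum_(z in F) gm_char M (z ^+ 2)%g.
Proof.
move=> sKF nzF nzK sqF; rewrite /fs_indicator.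
rewrite (eq_bigr (fun z => #|K|%:R^-1 *
    \sum_(y in F) gm_char M ((z ^ y) ^+ 2)%g)) => [|z Fz]; last first.
  rewrite gm_char_ind ?groupX //; congr (_ * _).
  apply: eq_big => [y|y _]; last by rewrite conjXg.
  by case Fy: (y \in F); rewrite //= conjXg sqF ?groupJ.
rewrite -mulr_sumr exchange_big /= mulrCA; congr (_ * _).
rewrite (eq_bigr (fun=> \sum_(z in F) gm_char M (z ^+ 2)%g)) => [|y Fy].
  by rewrite sumr_const -[X in _ * X]mulr_natl mulKf.
rewrite [RHS](reindex_inj (conjg_inj y)) /=.
by apply: eq_bigl => z; rewrite memJ_norm ?(subsetP (normG F)).
Qed.

(** * The indicator of the induced H-module *)

Section SchurIndicator.

Variables (k : fieldType) (gT lT : finGroupType) (a : left_aut_action lT gT).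
Local Notation p := (pbasis k a).

Lemma sweedler_square_std_integral :
  sweedler_square (std_integral k a) = #|lT|%:R^-1 *:
    \sum_(x : lT) \sum_(h : gT) (h == a x h^-1%g)%:R *: p h (x ^+ 2)%g.
Proof.
rewrite exchange_big /= /sweedler_square /tens_mul.
pose G (u v : gT * lT) := comul (std_integral k a) (u, v) *:
  (p u.1 u.2 * p v.1 v.2).
rewrite (eq_bigr (fun w => G w.1 w.2)) => [|[u v] _] //=.
rewrite -(pair_bigA _ G) /= [X in _ *: X]pair_bigA /= scaler_sumr.
(* The coproduct of p_1 x pairs p_h x only with p_(h^-1) x. *)
apply: eq_bigr => -[h x] _; rewrite (bigD1 (h^-1%g, x)) //= big1 ?addr0.
  rewrite /G comulE eqxx std_integralE mulgV eqxx mulr1 pbasisM.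
  by rewrite expgS expg1.
move=> [h' y] /= ne; rewrite /G comulE; case: eqP => [xy|_]; last first.
  by rewrite scale0r.
rewrite std_integralE; case: eqP => [hh'|_]; last by rewrite mulr0 scale0r.
case/eqP: ne; congr (_, _) => //.
by apply/eqP; rewrite eq_sym eq_invg_mul hh'.
Qed.

Variables (g : gT) (V : vectType k) (M : group_module (stab_group a g) V).
Hypothesis nzS : #|stab a g|%:R != 0 :> k.

Lemma hat_char_pbasis h x :
  am_char (hat_module M) (p h x) = #|stab a g|%:R^-1 *
    \sum_(y | (x ^ y)%g \in stab a g)
      (a y g == h)%:R * gm_char M (x ^ y)%g.
Proof.
rewrite /am_char /= hat_op_pbasis.
rewrite (@lftrace_ind _ _ _ _ _ _ _ _ _
  (fun y => (a (x * y)%g g == h)%:R) x) ?subsetT ?inE //; last first.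
  by move=> y v _; rewrite hat_basis_op_tens.
congr (_ * _); apply: eq_big => [y|y]; first by rewrite inE.
(* As y^-1 x y fixes g, xy and y move g to the same element. *)
case/andP=> _; rewrite inE conjgE => /eqP gy.
by congr ((_ == _)%:R * _); rewrite -[in RHS]gy -aut_actM mulKVg.
Qed.

Lemma hat_schur_indicator : #|lT|%:R != 0 :> k ->
  schur_indicator (std_integral k a) (am_char (hat_module M)) =
  #|stab a g|%:R^-1 *
    \sum_(x in transporter a g g^-1%g) gm_char M (x ^+ 2)%g.
Proof.
move=> nzL; rewrite /schur_indicator sweedler_square_std_integral.
rewrite am_charZ am_char_sum.
pose c := gm_char M.
rewrite (eq_bigr (fun x => #|stab a g|%:R^-1 *
  \sum_(y | (x ^ y)%g \in transporter a g g^-1%g) c ((x ^ y) ^+ 2)%g)).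
  rewrite -mulr_sumr mulrCA; congr (_ * _).
  rewrite (exchange_big_dep predT) //=.
  rewrite (eq_bigr (fun=> \sum_(x in transporter a g g^-1%g) c (x ^+ 2)%g)).
    by rewrite sumr_const cardT -cardE -[X in _ * X]mulr_natl mulKf.
  (* Conjugation by y makes the inner sum independent of y; the |L| equal copies cancel |L|^-1. *)
  by move=> y _; rewrite [RHS](reindex_inj (conjg_inj y)).
move=> x _; rewrite am_char_sum.
under eq_bigr => h _ do
  rewrite am_charZ hat_char_pbasis mulrCA mulr_sumr.
rewrite -mulr_sumr exchange_big /=; congr (_ * _).
rewrite big_mkcond [RHS]big_mkcond; apply: eq_bigr => y _.
(* For fixed x and y only h = y.g survives; the remaining delta then says that y^-1 x y sends g to
   g^-1. *)
rewrite (bigD1 (a y g)) //= big1 ?addr0 => [|h /negPf ne]; last first.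
  by rewrite [a y g == h]eq_sym ne mul0r mulr0.
rewrite eqxx mul1r conjXg -/c.
have -> : (a y g == a x (a y g)^-1%g) = ((x ^ y)%g \in transporter a g g^-1%g).
  rewrite inE conjgE !aut_actM -[RHS](inj_eq (can_inj (aut_actK a y))).
  by rewrite aut_actKV !aut_actV -[LHS](inj_eq invg_inj) invgK eq_sym.
(* An element inverting g has its square in the stabilizer, so the support condition of the
   character holds whenever the delta is nonzero. *)
case: ifP => [_|]; case: ifP => //=; rewrite ?mul1r ?mul0r // !inE => /eqP xg.
by rewrite expgS expg1 aut_actM xg aut_actV xg invgK eqxx.
Qed.

End SchurIndicator.

(** * Comparison with the local indicator *)

Lemma stab_sub_ext_stab (lT gT : finGroupType) (a : left_aut_action lT gT) g :
  stab_group a g \subset ext_stab_group a g.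
Proof. exact: subsetUl. Qed.

Lemma ext_stab_sqr (lT gT : finGroupType) (a : left_aut_action lT gT) g :
  {in ext_stab_group a g, forall z, (z ^+ 2)%g \in stab_group a g}.
Proof.
move=> z; rewrite !inE expgS expg1 aut_actM.
by case/orP=> /eqP zg; rewrite zg ?aut_actV zg ?invgK.
Qed.

Theorem theorem5p5 (k : closedFieldType) (gT lT : finGroupType)
  (a : left_aut_action lT gT)
  (char_neq2 : 2%N \notin [pchar k])
  (char_ndvd : [pchar k]^'.-nat (#|gT| * #|lT|)%N)
  (g : gT) (V : vectType k) (M : group_module (stab_group a g) V)
  (simpleM : simple_gm M)
  (Lam : smash k a) (Lam_int : hopf_integral Lam) (Lam1 : counit Lam = 1) :
  schur_indicator Lam (am_char (hat_module M)) = local_indicator M.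
Proof.
(* Subgroup orders divide |G||L|, hence are invertible in k. *)
have nz (F : {group lT}) : #|F|%:R != 0 :> k.
  rewrite natf_neq0_pchar; apply: pnat_dvd char_ndvd.
  by rewrite dvdn_mull // -cardsT cardSg ?subsetT.
have nzL : #|lT|%:R != 0 :> k by rewrite -cardsT (nz [group of [set: lT]]).
rewrite (integral_unique Lam_int Lam1 (@std_integralP _ _ _ _)); last first.
  exact: counit_std_integral.
rewrite hat_schur_indicator ?nz // /local_indicator expgS expg1 -eq_invg_mul.
(* If g = g^-1, the transporter is the stabilizer itself and the sum is the classical indicator. *)
case: eqP => [gV|/eqP gV]; first by rewrite /fs_indicator gV.
rewrite fs_indicator_ind ?stab_sub_ext_stab ?nz //; last exact: ext_stab_sqr.
(* A common element would send g both to g and to g^-1. *)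
have disj : [disjoint stab a g & transporter a g g^-1%g].
  rewrite disjoints_subset; apply/subsetP=> y.
  by rewrite !inE => /eqP->; rewrite eq_sym.
rewrite -mulrBr; congr (_ * _); apply/eqP; rewrite eq_sym subr_eq addrC.
by apply/eqP; rewrite -bigU //; apply: eq_bigl => z; rewrite !inE.
Qed.
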